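(* Let $L$ be a finite-dimensional completely solvable Leibniz $A$-algebra over a field $F$, and let $U$ be a maximal nilpotent subalgebra of $L$. Then there is a Cartan subalgebra $C$ of $L$ such that $U=(U\cap L^2)\oplus(U\cap C)$.
   Context: A (right) Leibniz algebra over $F$ is a vector space with a bilinear product $[\,,]$ satisfying $[x,[y,z]]=[[x,y],z]-[[x,z],y]$ for all $x,y,z$. $L^1=L$, $L^{k+1}=[L^k,L]$, so $L^2=[L,L]$; $L$ is nilpotent if $L^k=0$ for some $k$. $L$ is abelian if $[x,y]=0$ for all $x,y$. $L$ is an $A$-algebra if every nilpotent subalgebra of $L$ is abelian. $L$ is completely solvable if $L^2$ is nilpotent. A maximal nilpotent subalgebra is a nilpotent subalgebra not properly contained in another nilpotent subalgebra. A Cartan subalgebra $C$ of $L$ is a nilpotent subalgebra that equals its normaliser $\{x\in L : [x,C]\subseteq C \text{ and } [C,x]\subseteq C\}$. $\oplus$ denotes an algebra direct sum. *)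

(* Defs.v *)
From mathcomp Require Import all_boot all_algebra.

Set Implicit Arguments.
Unset Strict Implicit.
Unset Printing Implicit Defensive.

Import GRing.Theory.
Local Open Scope ring_scope.

Section LeibnizAlgebra.

Variables (F : fieldType) (L : vectType F) (br : {bilinear L -> L -> L}).

Implicit Types A B U V C : {vspace L}.

Definition right_leibniz : Prop :=
  forall x y z, br x (br y z) = br (br x y) z - br (br x z) y.

(* The span of all products br a b with a \in A and b \in B; it is generated
   by the products of basis vectors, see mem_bracketv and bracketvP. *)
Definition bracketv A B : {vspace L} :=
  <<[seq br a b | a <- vbasis A, b <- vbasis B]>>%VS.

Lemma mem_bracketv A B :
  {in A & B, forall a b, br a b \in bracketv A B}.
Proof.
move=> u v /coord_vbasis-> /coord_vbasis->.
rewrite linear_sumlz; apply: memv_suml => i _.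
rewrite linear_sumr; apply: memv_suml => j _.
rewrite linearZl_LR linearZr_LR !memvZ // /bracketv memv_span //.
by apply/allpairsP; exists ((vbasis A)`_i, (vbasis B)`_j); rewrite !memt_nth.
Qed.

Lemma bracketvP A B V :
  reflect {in A & B, forall a b, br a b \in V} (bracketv A B <= V)%VS.
Proof.
apply: (iffP idP) => [sABV a b Aa Bb | sABV].
  by rewrite (subvP sABV) ?mem_bracketv.
apply/span_subvP=> _ /allpairsP[[a b] /= [Aa Bb ->]].
by rewrite sABV ?vbasis_mem.
Qed.

(* A^1 = A and A^(k+1) = [A^k, A]; by convention A^0 = A as well. *)
Definition lower_central A (k : nat) : {vspace L} :=
  iter k.-1 (fun B => bracketv B A) A.

Definition subalgebra A : Prop := {in A &, forall x y, br x y \in A}.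

Definition is_nilpotent A : Prop := exists k : nat, lower_central A k = 0%VS.

Definition is_abelian A : Prop := {in A &, forall x y, br x y = 0}.

Definition A_algebra : Prop :=
  forall A, subalgebra A -> is_nilpotent A -> is_abelian A.

Definition completely_solvable : Prop := is_nilpotent (lower_central fullv 2).

Definition maximal_nilpotent U : Prop :=
  [/\ subalgebra U, is_nilpotent U &
      forall V, subalgebra V -> is_nilpotent V -> (U <= V)%VS -> V = U].

Definition normalises x C : Prop :=
  {in C, forall c, br x c \in C} /\ {in C, forall c, br c x \in C}.

Definition cartan C : Prop :=
  [/\ subalgebra C, is_nilpotent C & forall x, normalises x C <-> x \in C].

(* Direct sum of algebras, stronger than direct sum of vector spaces: the
   summands are subalgebras annihilating each other on both sides. *)
Definition algebra_direct_sum U A B : Prop :=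
  [/\ subalgebra A /\ subalgebra B,
      {in A & B, forall a b, br a b = 0 /\ br b a = 0},
      U = (A + B)%VS & (A :&: B)%VS = 0%VS].

End LeibnizAlgebra.

(* Main.v *)
Require Import Defs.
From mathcomp Require Import all_boot all_algebra.
From Stdlib Require Import Classical.

(* Put N = L^2; it is nilpotent, hence abelian, and so is U.  Right
   multiplications are derivations, and they commute on N.  The Fitting null
   component of a right multiplication by an element of a subalgebra K is a
   subalgebra, and it still supplements N if K does, because the Fitting one
   component lies in N.  So if H is minimal among the subalgebras that contain U
   and supplement N, every element of U acts nilpotently on H; then
   U + (H :&: N) is nilpotent, and maximality of U gives H :&: N <= U.
   Let C <= H be a minimal subalgebra with C + N = L.  All its right
   multiplications are nilpotent on C, so C is nilpotent, hence abelian, and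
   N = [N, C].  Therefore no nonzero element of N is annihilated by C, which
   yields C :&: N = 0 and makes C self-normalising.  Finally, if u = c + n is in
   U with c in C and n in N, then n = u - c is in H :&: N <= U. *)

Set Implicit Arguments.
Unset Strict Implicit.
Unset Printing Implicit Defensive.

Import GRing.Theory.
Local Open Scope ring_scope.

(** * Fitting decomposition and commuting nilpotent operators *)

Section LinearAlgebra.

Variables (F : fieldType) (E : vectType F).
Implicit Types (f g : 'End(E)) (K V : {vspace E}).

(** Induction on the dimension; since [P] is an arbitrary proposition, excluded middle decides
    whether a smaller subspace satisfies it. *)
Lemma minimal_subspace (P : {vspace E} -> Prop) V : P V ->
  exists K, [/\ (K <= V)%VS, P K & forall M, P M -> (M <= K)%VS -> M = K].
Proof.
have [n] := ubnP (\dim V); elim: n V => // n IHn V dV PV.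
have [[M [PM sMV nMV]]|noM] :=
    classic (exists M, [/\ P M, (M <= V)%VS & M <> V]).
  have dM : (\dim M < n)%N.
    rewrite ltnS in dV; apply: leq_trans dV; rewrite ltn_neqAle dimvS // andbT.
    by rewrite (dimv_leqif_eq sMV); apply/eqP.
  have [K [sKM PK minK]] := IHn M dM PM.
  by exists K; split => //; apply: subv_trans sMV.
exists V; split => // M PM sMV; apply: NNPP => nMV.
by apply: noM; exists M.
Qed.

Lemma descending_chain_stable (W : nat -> {vspace E}) :
  (forall i, W i.+1 <= W i)%VS -> exists m, W m.+1 = W m.
Proof.
move=> sW; have : forall i, (exists m, W m.+1 = W m) \/
    (\dim (W i) + i <= \dim (W 0%N))%N.
  elim=> [|i [|IHi]]; [by right; rewrite addn0 | by left |].
  have [eW|neW] := eqVneq (W i.+1) (W i); first by left; exists i.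
  right; apply: leq_trans IHi; rewrite addnS ltn_add2r ltn_neqAle dimvS ?andbT //.
  by rewrite (dimv_leqif_eq (sW i)).
case/(_ (\dim (W 0%N)).+1) => //.
by rewrite addnS ltnNge leq_addl.
Qed.

Definition nilpotent_on f V : Prop :=
  exists m, {in V, forall x, iter m f x = 0}.

Definition lfun_iter f m : 'End(E) := iter m (comp_lfun f) \1%VF.

Lemma lfun_iterE f m x : lfun_iter f m x = iter m f x.
Proof. by elim: m => [|m IHm]; rewrite /= lfunE //= IHm. Qed.

Lemma iter_lfun0 f m : iter m f 0 = 0.
Proof. by rewrite -lfun_iterE linear0. Qed.

Lemma iter_lfunD f m x y : iter m f (x + y) = iter m f x + iter m f y.
Proof. by rewrite -!lfun_iterE linearD. Qed.

Lemma iter_lfunB f m x y : iter m f (x - y) = iter m f x - iter m f y.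
Proof. by rewrite -!lfun_iterE linearB. Qed.

Lemma mem_iter_lfun f K m x : (f @: K <= K)%VS -> x \in K -> iter m f x \in K.
Proof.
move=> sfK Kx; elim: m => //= m IHm.
by apply: (subvP sfK); apply: memv_img.
Qed.

(** The images of [K] under the powers of [f] stabilise at [K1], on which [f] is bijective; [K0] is
    the kernel in [K] of the power reached. The last clause, valid for every exponent, is the
    membership test for [K0] used later. *)
Lemma fitting f K : (f @: K <= K)%VS -> 
  exists m (K0 : {vspace E}), let K1 := (lfun_iter f m @: K)%VS in
  [/\ K = (K0 + K1)%VS, (K0 :&: K1 = 0)%VS, (f @: K1 = K1)%VS,
      {in K0, forall x, iter m f x = 0}
    & forall m x, x \in K -> iter m f x = 0 -> x \in K0].
Proof.
move=> sfK; pose W m := (lfun_iter f m @: K)%VS.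
have WS m : W m.+1 = (f @: W m)%VS by rewrite -limg_comp.
have [m Wm] : exists m, W m.+1 = W m.
  apply: descending_chain_stable; elim=> [|i IHi]; first by rewrite WS /W lim1g.
  by rewrite !WS in IHi *; apply: limgS.
have fK1 : (f @: W m)%VS = W m by rewrite -WS.
have sK1K : (W m <= K)%VS.
  apply/subvP => _ /memv_imgP[x Kx ->]; rewrite lfun_iterE.
  exact: mem_iter_lfun.
have iterK1 x : x \in W m -> forall j, iter j f x \in W m.
  by move=> K1x j; apply: mem_iter_lfun => //; rewrite fK1.
(* By rank-nullity, [f] is injective on [W m], which it maps onto itself. *)
have injK1 x j : x \in W m -> iter j f x = 0 -> x = 0.
  move=> K1x; elim: j => //= j IHj fx0; apply: IHj.
  have := limg_ker_dim f (W m); rewrite fK1 => /eqP.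
  rewrite -[X in _ == X]add0n eqn_add2r dimv_eq0 => /eqP kerK1.
  by apply/eqP; rewrite -memv0 -kerK1 memv_cap iterK1 //= memv_ker fx0.
have itK1 j : (lfun_iter f j @: W m)%VS = W m.
  by elim: j => [|j IHj]; rewrite /= ?lim1g // limg_comp IHj.
exists m, (K :&: lker (lfun_iter f m))%VS; rewrite -/(W m) /=.
have defK : K = (K :&: lker (lfun_iter f m) + W m)%VS.
  apply/eqP; rewrite eqEsubv subv_add capvSl sK1K !andbT.
  apply/subvP => x Kx.
  have : lfun_iter f m x \in W m by apply: memv_img.
  rewrite -{1}(itK1 m) => /memv_imgP[y K1y Exy].
  rewrite -(subrK y x) memv_add // memv_cap memv_ker linearB /= Exy subrr eqxx.
  by rewrite andbT memvB // (subvP sK1K).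
split => //.
- apply/eqP; rewrite -subv0; apply/subvP => x.
  rewrite !memv_cap memv_ker lfun_iterE => /andP[/andP[_ /eqP fx0] K1x].
  by rewrite memv0 (injK1 _ _ K1x fx0).
- by move=> x; rewrite memv_cap memv_ker lfun_iterE => /andP[_ /eqP].
move=> j x; rewrite {1}defK => /memv_addP[a K0a [b K1b ->]] fab0.
rewrite (injK1 b (j + m)%N) ?addr0 //.
have : iter (j + m) f (a + b) = 0 by rewrite addnC iterD fab0 iter_lfun0.
rewrite iter_lfunD [iter _ f a]iterD; move: K0a.
rewrite memv_cap memv_ker lfun_iterE => /andP[_ /eqP->].
by rewrite iter_lfun0 add0r.
Qed.

Lemma iter_lfun_commute f g K m : (f @: K <= K)%VS ->
    {in K, forall x, f (g x) = g (f x)} ->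
  {in K, forall x, iter m f (g x) = g (iter m f x)}.
Proof.
move=> sfK comm x Kx; elim: m => //= m ->.
by rewrite comm // mem_iter_lfun.
Qed.

(* If J is the sum of the images of all but one f of the operators, iterating
   V <= f @: V + J gives V <= f^m @: V + J, so that f can be dropped. *)
Lemma commuting_nilpotent_sum_proper (s : seq 'End(E)) V :
    {in s, forall f, f @: V <= V}%VS ->
    {in s &, forall f g, {in V, forall v, f (g v) = g (f v)}} ->
    {in s, forall f, nilpotent_on f V} ->
  (V <= \sum_(f <- s) (f @: V))%VS -> V = 0%VS.
Proof.
elim: s => [|f s IHs] inv comm nil.
  by rewrite big_nil subv0 => /eqP.
rewrite big_cons; set J := (\sum_(_ <- s) _)%VS => sV.
have s_in g : g \in s -> g \in f :: s by rewrite inE orbC => ->.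
have fs := mem_head f s.
have sJV : (J <= V)%VS.
  rewrite /J big_seq; elim/big_rec: _ => [|g A sg sA]; first exact: sub0v.
  by rewrite subv_add inv ?s_in.
have sfJ : (f @: J <= J)%VS.
  rewrite limg_sum /J !big_seq.
  elim/big_rec2: _ => [|g A B sg sAB]; first exact: subvv.
  apply: addvS => //; apply/subvP => _ /memv_imgP[_ /memv_imgP[v Vv ->] ->].
  rewrite (comm f g fs (s_in g sg) v Vv); apply: memv_img.
  by apply: (subvP (inv f fs)); apply: memv_img.
have sVJ m : {in V, forall v, exists2 w, w \in V & v - iter m f w \in J}.
  elim: m => [|m IHm] v Vv; first by exists v => //=; rewrite subrr mem0v.
  have [w Vw Jvw] := IHm v Vv.
  have /memv_addP[_ /memv_imgP[w' Vw' ->] [j Jj Ew]] := subvP sV w Vw.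
  exists w' => //; rewrite iterSr.
  have -> : f w' = w - j by rewrite Ew addrK.
  by rewrite iter_lfunB opprB addrCA addrC memvD // mem_iter_lfun.
have [m fm0] := nil f fs.
apply: IHs => [g sg|g h sg sh|g sg|].
- by rewrite inv ?s_in.
- by apply: comm; apply: s_in.
- by apply: nil; apply: s_in.
apply/subvP => v Vv; have [w Vw] := sVJ m v Vv.
by rewrite fm0 // subr0.
Qed.

End LinearAlgebra.

(** * Right multiplications as derivations *)

Section Leibniz.

Variables (F : fieldType) (L : vectType F) (br : {bilinear L -> L -> L}).
Hypothesis leibniz : right_leibniz br.
Implicit Types A B K M U V : {vspace L}.

Local Notation N := (bracketv br fullv fullv).

Definition rmul (u : L) : 'End(L) := linfun (applyr br u).

Lemma rmulE u x : rmul u x = br x u.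
Proof. by rewrite lfunE. Qed.

Lemma bracketvS A A' B B' : (A <= A')%VS -> (B <= B')%VS ->
  (bracketv br A B <= bracketv br A' B')%VS.
Proof.
move=> sA sB; apply/bracketvP => a b Aa Bb.
by apply: mem_bracketv; [apply: (subvP sA) | apply: (subvP sB)].
Qed.

Lemma derived_mem x y : br x y \in N.
Proof. by apply: mem_bracketv; rewrite memvf. Qed.

Lemma rmul_derivation u x y :
  rmul u (br x y) = br (rmul u x) y + br x (rmul u y).
Proof. by rewrite !rmulE leibniz addrC subrK. Qed.

(** In the expansion of the power i + j of a derivation, every term differentiates [x] at least i
    times or [y] at least j times. Peeling off one derivation at a time avoids binomial
    coefficients. *)
Lemma iter_rmul_br u i j x y :
    iter i (rmul u) x = 0 -> iter j (rmul u) y = 0 ->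
  iter (i + j) (rmul u) (br x y) = 0.
Proof.
have [n] := ubnP (i + j)%N; elim: n i j x y => // n IHn [|i] j x y.
  by move=> _ x0 _; rewrite [x]x0 linear0l iter_lfun0.
case: j => [|j]; first by move=> _ _ y0; rewrite [y]y0 linear0r iter_lfun0.
rewrite ltnS => lt_n ix jy; rewrite addSn iterSr rmul_derivation iter_lfunD.
rewrite (IHn i j.+1) ?add0r -?iterSr //.
by rewrite addnS -addSn (IHn i.+1 j) -?iterSr // addSn -addnS.
Qed.

Lemma fitting_null_subalgebra K u : subalgebra br K -> u \in K ->
  exists K0, [/\ (K0 <= K)%VS, subalgebra br K0, (K <= K0 + N)%VS,
    nilpotent_on (rmul u) K0
    & forall m x, x \in K -> iter m (rmul u) x = 0 -> x \in K0].
Proof.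
move=> subK Ku.
have sfK : (rmul u @: K <= K)%VS.
  by apply/subvP => _ /memv_imgP[x Kx ->]; rewrite rmulE subK.
have [m [K0 [defK _ fK1 nilK0 K0P]]] := fitting sfK.
have sK0 : (K0 <= K)%VS by rewrite defK addvSl.
exists K0; split => //.
- move=> x y K0x K0y; apply: (K0P (m + m)%N).
    by apply: subK; apply: (subvP sK0).
  by apply: iter_rmul_br; apply: nilK0.
(* The one component is its own image under [rmul u], so it consists of products. *)
- rewrite {1}defK; apply: addvS => //; rewrite -fK1.
  by apply/subvP => _ /memv_imgP[x _ ->]; rewrite rmulE derived_mem.
by exists m.
Qed.

(** * Algebras whose derived algebra is abelian *)

Hypothesis derived_abelian : is_abelian br N.

(** By the Leibniz identity the two sides differ by [br n (br y z)], a product of two elements of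
    [N]. *)
Lemma rmul_commute_derived y z : {in N, forall n, br (br n y) z = br (br n z) y}.
Proof.
move=> n Nn; apply/eqP; rewrite -subr_eq0 -leibniz.
by rewrite derived_abelian // derived_mem.
Qed.

Lemma nil_action_proper A V : (V <= N)%VS ->
    {in V & A, forall v a, br v a \in V} ->
    {in A, forall a, nilpotent_on (rmul a) V} ->
  (V <= bracketv br V A)%VS -> V = 0%VS.
Proof.
move=> sVN inv nil sV.
apply: (@commuting_nilpotent_sum_proper _ _ [seq rmul a | a <- vbasis A]).
- move=> _ /mapP[a /vbasis_mem Aa ->]; apply/subvP => _ /memv_imgP[v Vv ->].
  by rewrite rmulE inv.
- move=> _ _ /mapP[a _ ->] /mapP[b _ ->] v Vv.
  by rewrite !rmulE rmul_commute_derived // (subvP sVN).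
- by move=> _ /mapP[a /vbasis_mem Aa ->]; apply: nil.
apply: subv_trans sV _; apply/bracketvP => v a Vv /coord_vbasis->.
rewrite linear_sumr big_map; apply: memv_suml => i _.
rewrite linearZr_LR memvZ //= (big_rem (vbasis A)`_i) ?memt_nth //=.
by apply: (subvP (addvSl _ _)); rewrite -rmulE memv_img.
Qed.

(** An Engel-type criterion: bracketing [V] repeatedly with [A] gives a descending chain, whose
    stable term vanishes by [nil_action_proper]. *)
Lemma nil_action_nilpotent A V : (V <= N)%VS -> (bracketv br A A <= V)%VS ->
    {in V & A, forall v a, br v a \in V} ->
    {in A, forall a, nilpotent_on (rmul a) V} ->
  is_nilpotent br A.
Proof.
move=> sVN sAV inv nil; pose W i := iter i (fun B => bracketv br B A) V.
have sW i : (W i.+1 <= W i)%VS.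
  elim: i => [|i IHi] /=; first by apply/bracketvP.
  exact: bracketvS.
have sWV i : (W i <= V)%VS.
  by elim: i => // i IHi; apply: subv_trans (sW i) IHi.
have [m Wm] := descending_chain_stable sW.
have W0 : W m = 0%VS.
  apply: (@nil_action_proper A).
  - exact: subv_trans (sWV m) sVN.
  - by move=> v a Wv Aa; rewrite -Wm; apply: mem_bracketv.
  - move=> a Aa; have [k nilk] := nil a Aa.
    by exists k => v Wv; apply: nilk; apply: (subvP (sWV m)).
  - by rewrite -[X in (X <= _)%VS]Wm.
(* The term of index m + 2 involves m + 1 brackets: one to enter [V], then m to reach [W m]. *)
exists m.+2; apply/eqP; rewrite -subv0 -W0 /lower_central /= /W.
elim: m {Wm W0} => [|m IHm] //=; exact: bracketvS.
Qed.

(* On a minimal M containing z with M <= [M, K], all operators from K are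
   nilpotent, for the Fitting null component of each of them is again such. *)
Lemma faithful_action K z :
    (N <= bracketv br N K)%VS -> z \in N -> {in K, forall k, br z k = 0} ->
  z = 0.
Proof.
move=> sN Nz zK.
pose P V := [/\ (V <= N)%VS, {in V & K, forall v k, br v k \in V},
                (V <= bracketv br V K)%VS & z \in V].
have PN : P N by split => // v k _ _; apply: derived_mem.
have [M [_ [sMN invM sM Mz] minM]] := minimal_subspace PN.
suff M0 : M = 0%VS by apply/eqP; rewrite -memv0 -M0.
apply: (@nil_action_proper K) => // k Kk.
have sfM : (rmul k @: M <= M)%VS.
  by apply/subvP => _ /memv_imgP[v Mv ->]; rewrite rmulE invM.
have comm a m : {in M, forall v,
    iter m (rmul k) (br v a) = br (iter m (rmul k) v) a}.
  move=> v Mv; rewrite -!rmulE (iter_lfun_commute (K := M)) // => w Mw.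
  by rewrite !rmulE rmul_commute_derived // (subvP sMN).
have [m [M0 [defM dxM fM1 nilM0 M0P]]] := fitting sfM.
have sM0M : (M0 <= M)%VS by rewrite defM addvSl.
exists m; suff <- : M0 = M by [].
have invM0 : {in M0 & K, forall v a, br v a \in M0}.
  move=> v a M0v Ka; have Mv := subvP sM0M v M0v.
  by apply: (M0P m); rewrite ?invM // comm // nilM0 // linear0l.
apply: minM => //; split => //; first exact: subv_trans sM0M sMN.
  (* Bracketing with [K] preserves both Fitting components, and their sum is direct, so the
     inclusion of [M] in [[M, K]] restricts to [M0]. *)
  have: (M <= bracketv br M0 K + lfun_iter (rmul k) m @: M)%VS.
    apply: subv_trans sM _; apply/bracketvP => v a.
    rewrite {1}defM => /memv_addP[b M0b [_ /memv_imgP[c Mc ->] ->]] Ka.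
    rewrite linearDl memv_add ?mem_bracketv // lfun_iterE -comm // -lfun_iterE.
    by rewrite memv_img // invM.
  move=> sM'; apply/subvP => v M0v.
  have /memv_addP[a M0a [b M1b Ev]] := subvP sM' v (subvP sM0M v M0v).
  suff b0 : b = 0 by rewrite Ev b0 addr0.
  apply/eqP; rewrite -memv0 -dxM memv_cap M1b andbT.
  have -> : b = v - a by rewrite Ev addrC addKr.
  by rewrite memvB //; move: a M0a {Ev}; apply/subvP/bracketvP.
by apply: (M0P 1%N) => //=; rewrite rmulE zK.
Qed.

(** If [k] annihilates [T] from the right, then [T] lies in the Fitting null component of [rmul k],
    which therefore competes with a minimal [K] and must equal it. *)
Lemma minimal_supplement H T : subalgebra br H -> (T <= H)%VS ->
    (fullv <= H + N)%VS ->
  exists K, [/\ (K <= H)%VS, subalgebra br K, (T <= K)%VS, (fullv <= K + N)%VS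
    & {in K, forall k, {in T, forall t, br t k = 0} -> nilpotent_on (rmul k) K}].
Proof.
move=> subH sTH sH.
pose P K := [/\ subalgebra br K, (T <= K)%VS & (fullv <= K + N)%VS].
have PH : P H by split.
have [K [sKH [subK sTK sK] minK]] := minimal_subspace PH.
exists K; split => // k Kk Tk.
have [K0 [sK0 subK0 sKK0 nilK0 K0P]] := fitting_null_subalgebra subK Kk.
rewrite -(minK K0) //; split => //.
  apply/subvP => t Tt; apply: (K0P 1%N); first exact: (subvP sTK).
  by rewrite /= rmulE Tk.
by apply: subv_trans sK _; rewrite subv_add sKK0 addvSr.
Qed.

(** Since [[N, N] = 0], [[N, L] = [N, K]]; the Leibniz identity puts [[L, N]] into [[N, L]], and
    [[K, K] = 0] disposes of the remaining products. *)
Lemma derived_bracket_supplement K : is_abelian br K -> (fullv <= K + N)%VS ->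
  (N <= bracketv br N K)%VS.
Proof.
move=> abK sK.
have decomp x : exists k n, [/\ k \in K, n \in N & x = k + n].
  have /memv_addP[k Kk [n Nn ->]] := subvP sK x (memvf x).
  by exists k, n.
have brN n b : n \in N -> br n b \in bracketv br N K.
  move=> Nn; have [k [n' [Kk Nn' ->]]] := decomp b.
  by rewrite linearDr [br n n']derived_abelian // addr0 mem_bracketv.
have brxN x n : n \in N -> br x n \in bracketv br N K.
  move=> Nn; suff : (N <= linfun (br x) @^-1: bracketv br N K)%VS.
    by move/subvP/(_ n Nn); rewrite -memv_preim lfunE.
  apply/bracketvP => a b _ _; rewrite -memv_preim lfunE /= leibniz.
  by rewrite memvB // brN // derived_mem.
apply/bracketvP => a b _ _; have [k [n [Kk Nn ->]]] := decomp a.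
have [k' [n' [Kk' Nn' ->]]] := decomp b.
rewrite linearDl; apply: memvD; last exact: brN.
by rewrite linearDr [br k k']abK // add0r brxN.
Qed.

Lemma rmul_nilpotent_subalgebra K : subalgebra br K ->
    {in K, forall k, nilpotent_on (rmul k) K} -> is_nilpotent br K.
Proof.
move=> subK nilK.
apply: (@nil_action_nilpotent K (K :&: N)%VS); first exact: capvSr.
- by apply/bracketvP => a b Ka Kb; rewrite memv_cap subK ?derived_mem.
- by move=> v a /memv_capP[Kv _] Ka; rewrite memv_cap subK ?derived_mem.
move=> k /nilK[m nilk]; exists m => v /memv_capP[Kv _]; exact: nilk.
Qed.

Lemma cap_derived_sub_maximal U H : is_abelian br U ->
    maximal_nilpotent br U -> subalgebra br H -> (U <= H)%VS ->
    {in U, forall u, nilpotent_on (rmul u) H} -> (H :&: N <= U)%VS.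
Proof.
move=> abU [_ _ maxU] subH sUH nilU; set V := (H :&: N)%VS.
have sAH : (U + V <= H)%VS by rewrite subv_add sUH capvSl.
have brV : {in H &, forall a b, br a b \in V}.
  by move=> a b Ha Hb; rewrite memv_cap subH ?derived_mem.
rewrite -(maxU (U + V)%VS) ?addvSl ?addvSr //.
  move=> a b Aa Ab; apply: (subvP (addvSr U V)).
  by apply: brV; apply: (subvP sAH).
apply: (@nil_action_nilpotent _ V); first exact: capvSr.
- by apply/bracketvP => a b Aa Ab; apply: brV; apply: (subvP sAH).
- by move=> v a /memv_capP[Hv _] Aa; apply: brV => //; apply: (subvP sAH).
move=> _ /memv_addP[u Uu [v /memv_capP[Hv Nv] ->]].
have [m nilu] := nilU u Uu; exists m => x /memv_capP[Hx Nx].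
rewrite -[RHS](nilu x Hx).
(* Right multiplications by [u + v] and by [u] agree on [N], because [v] lies in the abelian [N]. *)
elim: m {nilu} => //= m ->; rewrite !rmulE linearDr.
rewrite [br _ v]derived_abelian ?addr0 //.
apply: mem_iter_lfun => //; apply/subvP => _ /memv_imgP[y _ ->].
by rewrite rmulE derived_mem.
Qed.

Lemma cartan_supplement K : subalgebra br K -> is_nilpotent br K ->
    is_abelian br K -> (fullv <= K + N)%VS ->
  cartan br K /\ (K :&: N = 0)%VS.
Proof.
move=> subK nilK abK sK.
have central z : z \in N -> {in K, forall k, br z k = 0} -> z = 0.
  by move=> Nz; apply: faithful_action Nz; apply: derived_bracket_supplement.
have KN0 : (K :&: N = 0)%VS.
  apply/eqP; rewrite -subv0; apply/subvP => z /memv_capP[Kz Nz].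
  by rewrite memv0 (central z) // => k Kk; apply: abK.
split => //; split => // x; split=> [[xK Kx]|Kx]; last first.
  by split => k Kk; apply: subK.
have /memv_addP[k Kk [n Nn Ex]] := subvP sK x (memvf x).
(* [n, K] lies in both K and N, hence vanishes. *)
suff n0 : n = 0 by rewrite Ex n0 addr0.
apply: central => // k' Kk'; apply/eqP.
rewrite -memv0 -KN0 memv_cap derived_mem andbT.
have -> : n = x - k by rewrite Ex addrC addKr.
by rewrite linearBl memvB ?xK ?subK.
Qed.

End Leibniz.

Theorem theorem4p5 (F : fieldType) (L : vectType F)
    (br : {bilinear L -> L -> L}) (hL : right_leibniz br)
    (hA : A_algebra br) (hs : completely_solvable br)
    (U : {vspace L}) (hU : maximal_nilpotent br U) :
  exists C : {vspace L}, cartan br C /\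
    algebra_direct_sum br U
      (U :&: lower_central br fullv 2)%VS (U :&: C)%VS.
Proof.
rewrite /lower_central /=; set N := bracketv br fullv fullv.
have subN : subalgebra br N by move=> x y _ _; apply: derived_mem.
have abN : is_abelian br N by apply: hA.
have [subU nilU _] := hU; have abU : is_abelian br U by apply: hA.
have [H [_ subH sUH sH nilH]] : exists H, [/\ (H <= fullv)%VS, subalgebra br H,
    (U <= H)%VS, (fullv <= H + N)%VS & {in H, forall k,
    {in U, forall t, br t k = 0} -> nilpotent_on (rmul br k) H}].
  apply: minimal_supplement; rewrite ?subvf ?addvSl // => x y _ _.
  exact: memvf.
have sHNU : (H :&: N <= U)%VS.
  apply: cap_derived_sub_maximal => // u Uu.
  by apply: nilH => [|t Ut]; [apply: (subvP sUH) | apply: abU].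
(* With [T = 0] the annihilation condition is vacuous, so every element of [K] acts nilpotently on
   [K]. *)
have [K [sKH subK _ sK nilK]] := minimal_supplement hL subH (sub0v H) sH.
have {}nilK : {in K, forall k, nilpotent_on (rmul br k) K}.
  by move=> k Kk; apply: nilK => // t; rewrite memv0 => /eqP->; rewrite linear0l.
have nilpK := rmul_nilpotent_subalgebra hL abN subK nilK.
have abK := hA K subK nilpK.
have [cK KN0] := cartan_supplement hL abN subK nilpK abK sK.
exists K; split => //; split.
- split=> x y /memv_capP[Ux Zx] /memv_capP[Uy Zy]; rewrite memv_cap subU //=.
    exact: subN.
  exact: subK.
- by move=> a b /memv_capP[Ua _] /memv_capP[Ub _]; rewrite !abU.
- apply/eqP; rewrite eqEsubv subv_add !capvSl !andbT; apply/subvP => u Uu.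
  have /memv_addP[k Kk [n Nn Eu]] := subvP sK u (memvf u).
  have Un : n \in U.
    apply: (subvP sHNU); rewrite memv_cap Nn andbT.
    have -> : n = u - k by rewrite Eu addrC addKr.
    by apply: memvB; [apply: (subvP sUH) | apply: (subvP sKH)].
  have Uk : k \in U by rewrite -(addrK n k) -Eu memvB.
  by rewrite Eu addrC memv_add // memv_cap ?Un ?Uk.
apply/eqP; rewrite -subv0 -KN0; apply/subvP => x.
by rewrite !memv_cap => /andP[/andP[_ ->] /andP[_ ->]].
Qed.
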